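(* For $m\ge1$ let $S_m=\sum_T(-1)^{u(T)}$, the sum over all $\{uu,dd,h\}$-avoiding (alternating) GNC-trees $T$ with $m$ vertices, where $u(T)$ is the number of ascents of $T$. Then for every $n\ge0$, $S_{2n+3}=0$ and $S_{2n+2}=(-1)^{n+1}2^nC_n$, where $C_n=\frac{1}{n+1}\binom{2n}{n}$.
   Context: A non-crossing tree on $n+1$ points: place $n+1$ points $p_0,\dots,p_n$ on a circle in counterclockwise order and draw a tree on them with straight edges inside the circle, no two crossing. A (rooted) GNC-tree with $n+1$ vertices is such a tree with a labelling of the points by positive integers, weakly increasing along $p_0,\dots,p_n$, $p_0$ labelled 1, label set $\{1,\dots,m\}$ for some $m$; rooted at $p_0$. Orient each edge from parent (closer to root) to child; it is an ascent ($u$) if parent label $<$ child label, a level ($h$) if equal, a descent ($d$) if larger. Each root-to-vertex path gives a word over $\{u,h,d\}$; a tree contains $\sigma$ if some such word contains $\sigma$ as a contiguous factor. A $\{uu,dd,h\}$-avoiding GNC-tree is one containing none of $uu$, $dd$, $h$. The paper calls $S_m$ the ''parity'' of the number of alternating GNC-trees of $m$ points according to even or odd number of ascents. *)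

(* Defs.v *)
From HB Require Import structures.
From mathcomp Require Import all_boot all_order all_algebra.

Set Implicit Arguments.
Unset Strict Implicit.
Unset Printing Implicit Defensive.

Import GRing.Theory.

(* The points p_0, ..., p_n are the elements of 'I_n.+1 in counterclockwise
   order; a simple graph on them is its set of edges, an edge being the
   two-element set of its endpoints. *)
Section Graph.
Variable n : nat.
Implicit Types (E : {set {set 'I_n.+1}}) (x y : 'I_n.+1).

Definition simple_graph E := [forall e in E, #|e| == 2].

Definition adj E : rel 'I_n.+1 := [rel x y | [set x; y] \in E].

Definition connected E := [forall x, forall y, connect (adj E) x y].

(* A closed sequence of distinct vertices of size 2 is just an edge traversed
   back and forth. The bound on the size makes this decidable; it loses
   nothing, see acyclicP. *)
Definition acyclic E :=
  [forall k : 'I_n.+2, forall c : k.-tuple 'I_n.+1,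
     ucycleb (adj E) c ==> (size c <= 2)].

Lemma acyclicP E :
  reflect (forall c, ucycle (adj E) c -> size c <= 2) (acyclic E).
Proof.
apply: (iffP forallP) => [acE c ucc | acE k].
  have sz_c : size c < n.+2.
    by case/andP: ucc => _ /card_uniqP <-; rewrite ltnS (leq_trans (max_card _)) ?card_ord.
  have /forallP/(_ (in_tuple c))/implyP := acE (Ordinal sz_c).
  exact.
by apply/forallP => c; apply/implyP; exact: acE.
Qed.

Definition is_tree E := [&& simple_graph E, connected E & acyclic E].

(* Two chords of a circle cross in the interior iff their endpoints alternate
   around the circle. *)
Definition non_crossing E :=
  [forall a : 'I_n.+1, forall b : 'I_n.+1,
   forall c : 'I_n.+1, forall d : 'I_n.+1,
     [&& a < b, b < c & c < d] ==> ~~ (adj E a c && adj E b d)].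

(* Distance to the root p_0 (n.+1 if x is not reachable). *)
Definition depth E x :=
  find (fun k => [exists w : k.-tuple 'I_n.+1,
                    path (adj E) ord0 w && (last ord0 w == x)])
       (iota 0 n.+1).

Definition parent E : rel 'I_n.+1 :=
  [rel x y | adj E x y && (depth E x < depth E y)].

End Graph.

(* The letters u, h, d of the words are asc, lev, des. *)
Inductive step := asc | lev | des.

Definition eq_step (s t : step) :=
  match s, t with asc, asc | lev, lev | des, des => true | _, _ => false end.

Lemma eq_stepP : Equality.axiom eq_step.
Proof. by do 2!case; constructor. Qed.

HB.instance Definition _ := hasDecEq.Build step eq_stepP.

(* Labels lie in {1, ..., n + 1}: n + 1 points whose label set is {1, ..., m}
   have m <= n + 1. The value 0 of 'I_n.+2 is excluded by is_labelling. *)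
Section Labelled.
Variable n : nat.
Implicit Types (E : {set {set 'I_n.+1}}) (f : {ffun 'I_n.+1 -> 'I_n.+2}).

Definition is_labelling f :=
  [&& [forall i : 'I_n.+1, forall j : 'I_n.+1, (i <= j) ==> (f i <= f j)],
      f ord0 == 1 :> nat
    & [exists m : 'I_n.+2,
         [set f i | i : 'I_n.+1] == [set l : 'I_n.+2 | 1 <= l <= m]]].

Definition gnc_tree E f := [&& is_tree E, non_crossing E & is_labelling f].

Definition edge_step f (x y : 'I_n.+1) : step :=
  if f x < f y then asc else if f x == f y then lev else des.

(* p lists the vertices visited after the root. Depth increases along a path
   from parents to children, so such a path has at most n edges. *)
Definition word f (p : seq 'I_n.+1) : seq step := pairmap (edge_step f) ord0 p.

Definition contains E f (s : seq step) :=
  [exists k : 'I_n.+1, exists p : k.-tuple 'I_n.+1,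
     path (parent E) ord0 p && infix s (word f p)].

Definition alternating E f :=
  [&& ~~ contains E f [:: asc; asc], ~~ contains E f [:: des; des]
    & ~~ contains E f [:: lev]].

Definition ascents E f :=
  #|[set e : 'I_n.+1 * 'I_n.+1 |
      parent E e.1 e.2 && (edge_step f e.1 e.2 == asc)]|.

End Labelled.

(* The sum is over trees with m vertices; parity_sum 0 is a dummy value. *)
Definition parity_sum (m : nat) : int :=
  if m is n.+1 then
    (\sum_(T : {set {set 'I_n.+1}} * {ffun 'I_n.+1 -> 'I_n.+2}
           | gnc_tree T.1 T.2 && alternating T.1 T.2)
       (-1) ^+ ascents T.1 T.2)%R
  else 0%R.

Definition catalan (n : nat) : nat := 'C(2 * n, n) %/ n.+1.

Lemma catalanE n : catalan n * n.+1 = 'C(2 * n, n).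
Proof.
rewrite divnK // -(@Gauss_dvdr _ n) ?coprimeSn //.
by have := mul_bin_left (2 * n) n; rewrite mul2n -addnn addnK => <-; apply: dvdn_mulr.
Qed.

(* Main.v *)
From HB Require Import structures.
Require Import Defs.
From mathcomp Require Import all_boot all_order all_algebra.
From mathcomp Require Import zify ring.

(* In an alternating tree all neighbours of a vertex lie on the same side of
   it, and the ascents correspond to the vertices having a smaller neighbour.
   Such a non-crossing tree on a, ..., b (a < b) contains the edge {a, b};
   deleting it leaves two such trees on a, ..., k and k+1, ..., b, so these
   trees are encoded by binary trees. A weakly increasing labelling amounts to the set
   of i with a label jump between p_i and p_{i+1}; it has no level iff it jumps
   at each edge {p_i, p_{i+1}}, because every edge spans one of these. A tree
   with n edges, s of them of this kind, thus has 2^(n-s) labellings. With A_n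
   the signed total weight, F = \sum_{n >= 1} A_n x^n satisfies
   F = -x + 2 x F^2, hence F = -x c(-2 x^2) with c the Catalan series. *)

Set Implicit Arguments.
Unset Strict Implicit.
Unset Printing Implicit Defensive.

Import GRing.Theory Num.Theory.

Arguments adj : simpl never.

(** * Binary trees as edge sets on an interval *)

Inductive bintree := Leaf | Node of bintree & bintree.

Definition is_leaf t := if t is Leaf then true else false.

Fixpoint eq_bintree s t :=
  match s, t with
  | Leaf, Leaf => true
  | Node l r, Node l' r' => eq_bintree l l' && eq_bintree r r'
  | _, _ => false
  end.

Lemma eq_bintreeP : Equality.axiom eq_bintree.
Proof.
elim=> [|l IHl r IHr] [|l' r'] /=; try by constructor.
by apply: (iffP andP) => [[/IHl -> /IHr ->] // | [<- <-]]; split; [exact/IHl | exact/IHr].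
Qed.

HB.instance Definition _ := hasDecEq.Build bintree eq_bintreeP.

Fixpoint nedges t := if t is Node l r then (nedges l + nedges r).+1 else 0.

(** A leaf stands for a single point, so a tree with k edges occupies the k + 1 points a, ..., a +
    k; hence the successor in the starting point of [r]. Each edge is stored as a pair with its
    smaller end first. *)
Fixpoint edges t a : seq (nat * nat) :=
  if t is Node l r then
    (a, a + nedges t) :: edges l a ++ edges r (a + nedges l).+1
  else [::].

Lemma mem_edges_Node l r a e :
  (e \in edges (Node l r) a) =
  [|| e == (a, a + nedges (Node l r)), e \in edges l a
    | e \in edges r (a + nedges l).+1].
Proof. by rewrite inE mem_cat. Qed.

Lemma edges_bound t a x y :
  (x, y) \in edges t a -> [&& a <= x, x < y & y <= a + nedges t].
Proof.
elim: t a => [|l IHl r IHr] a //.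
rewrite mem_edges_Node => /or3P[/eqP[-> ->]|/IHl|/IHr] /=; lia.
Qed.

Lemma edges_nc t a x x' y y' :
  (x, y) \in edges t a -> (x', y') \in edges t a ->
  x < x' -> x' < y -> y < y' -> False.
Proof.
elim: t a => [|l IHl r IHr] a //; rewrite !mem_edges_Node.
case/or3P=> [/eqP[-> ->]|H|H]; case/or3P=> [/eqP[-> ->]|H'|H'];
  by [move: (IHl _ H H') | move: (IHr _ H H')
     | try move/edges_bound: H => H; try move/edges_bound: H' => H';
       move=> /= *; lia].
Qed.

Lemma edges_alt t a x y z :
  (x, y) \in edges t a -> (y, z) \in edges t a -> False.
Proof.
elim: t a => [|l IHl r IHr] a //; rewrite !mem_edges_Node.
case/or3P=> [/eqP[? ?]|H|H]; case/or3P=> [/eqP[? ?]|H'|H'];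
  by [move: (IHl _ H H') | move: (IHr _ H H')
     | try move/edges_bound: H => H; try move/edges_bound: H' => H';
       simpl in *; lia].
Qed.

(** Connectedness by cuts instead of paths: a predicate that separates two points must separate the
    ends of an edge. In this form it passes to subintervals by extending a predicate by a constant.
    Edges are meant to be increasing, so x is only bounded below and y only above. *)
Definition connected_on (e : rel nat) a b := forall P : pred nat,
  (forall x y, a <= x -> y <= b -> e x y -> P x = P y) ->
  forall u v, a <= u <= b -> a <= v <= b -> P u = P v.

Lemma edges_connected t a :
  connected_on (fun x y => (x, y) \in edges t a) a (a + nedges t).
Proof.
elim: t a => [|l IHl r IHr] a P HP u v Hu Hv.
  by have -> : u = v by simpl in *; lia.
have Hl w : a <= w <= a + nedges l -> P w = P a.
  move=> Hw; apply: (IHl a P) => //; last by lia.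
  by move=> x y xa yb xy; apply: HP; rewrite ?mem_edges_Node ?xy ?orbT //=; lia.
have Hr w : a + nedges l < w <= a + nedges (Node l r) ->
    P w = P (a + nedges (Node l r)).
  move=> /= Hw; apply: (IHr (a + nedges l).+1 P); try lia.
  by move=> x y xa yb xy; apply: HP; rewrite ?mem_edges_Node ?xy ?orbT //=; lia.
have Hab : P a = P (a + nedges (Node l r)).
  by apply: HP; rewrite ?mem_edges_Node ?eqxx.
suff Hw w : a <= w <= a + nedges (Node l r) -> P w = P a by rewrite !Hw.
move=> Hw; case: (leqP w (a + nedges l)) => wl; first by apply: Hl; lia.
by rewrite Hr ?Hab //; lia.
Qed.

(** The edge set determines the size of the left subtree, and then each subtree is recovered by
    restricting to its interval. *)
Lemma edges_inj s t a : nedges s = nedges t -> edges s a =i edges t a -> s = t.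
Proof.
elim: s t a => [|l IHl r IHr] [|l' r'] a //= [sz] E.
have Ee e : e \in edges (Node l r) a = (e \in edges (Node l' r') a) by apply: E.
have root u v : u != Leaf -> (a, a + nedges u) \in edges (Node u v) a.
  by case: u => // u1 u2 _; rewrite !mem_edges_Node eqxx orbT.
(* The edge spanning a nonempty [u] is too short to be the root edge on the other side and starts
   too early for [v'], so it belongs to [u']. *)
have half u v u' v' : edges (Node u v) a =i edges (Node u' v') a ->
    nedges u + nedges v = nedges u' + nedges v' -> nedges u <= nedges u'.
  move=> Euv suv; case: (eqVneq u Leaf) => [-> //|uL].
  have := root u v uL; rewrite Euv mem_edges_Node => /or3P[/eqP[]|/edges_bound|/edges_bound] /=; lia.
have szl : nedges l = nedges l'.
  by apply/eqP; rewrite eqn_leq (half l r l' r') ?(half l' r' l r) // => e;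
     rewrite Ee.
have szr : nedges r = nedges r' by lia.
congr Node.
- apply: (IHl _ a) => // -[x y]; have := Ee (x, y); rewrite !mem_edges_Node /= -szl -szr.
  apply: contra_eq => Hne.
  (* A pair on which the two left subtrees disagree lies in one of them, hence in the left interval,
     which the root edge and the right subtrees do not meet. *)
  have Hb : (y <= a + nedges l).
    move: Hne; case: (boolP ((x, y) \in edges l a)) => [/edges_bound|_]; first lia.
    by case: (boolP ((x, y) \in edges l' a)) => [/edges_bound|_] //; lia.
  have Nr s : (x, y) \in edges s (a + nedges l).+1 = false.
    by apply/negP => /edges_bound; lia.
  rewrite !Nr !orbF (_ : ((x, y) == _) = false) //.
  by apply/negP => /eqP[_]; lia.
- apply: (IHr _ (a + nedges l).+1) => // -[x y].
  have := Ee (x, y); rewrite !mem_edges_Node /= -szl -szr.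
  apply: contra_eq => Hne.
  have Hb : (a + nedges l < x).
    move: Hne; case: (boolP ((x, y) \in edges r _)) => [/edges_bound|_]; first lia.
    by case: (boolP ((x, y) \in edges r' _)) => [/edges_bound|_] //; lia.
  have Nr s : nedges s = nedges l -> (x, y) \in edges s a = false.
    by move=> ss; apply/negP => /edges_bound; lia.
  rewrite !Nr // (_ : ((x, y) == _) = false) //.
  by apply/negP => /eqP[]; lia.
Qed.

(** Strong induction on n: the only edge between the two intervals cut out below is (a, b), so each
    of them is connected by itself. *)
Lemma alt_nc_connected_edges (e : rel nat) a n :
  (forall x y, e x y -> x < y) ->
  (forall x x' y y', e x y -> e x' y' -> x < x' -> x' < y -> y < y' -> False) ->
  (forall x y z, e x y -> e y z -> False) ->
  connected_on e a (a + n) ->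
  exists2 t, nedges t = n &
    forall x y, a <= x -> y <= a + n -> e x y = ((x, y) \in edges t a).
Proof.
move=> e_lt nc alt; elim/ltn_ind: n a => n IH a con.
case: n => [|n] in IH con *.
  exists Leaf => // x y xa ya; apply/negP => /e_lt; lia.
set b := a + n.+1 in con *.
(* Otherwise, with y the largest neighbour of a, no edge would leave [a, y]. *)
have eab : e a b.
  pose Q y := (a <= y <= b) && ((y == a) || e a y).
  have exQ : exists y, Q y by exists a; rewrite /Q eqxx; lia.
  have ubQ y : Q y -> y <= b by case/andP; lia.
  case: (ex_maxnP exQ ubQ) => y /andP[yb Qy] ymax.
  case: (eqVneq y b) => [yEb | ynb].
    by case/orP: Qy; rewrite yEb // /b; lia.
  suff : (a <= y) = (b <= y) by lia.
  apply: (con (fun w => w <= y)); [|lia|lia].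
  move=> u v ua vb uv; have uv1 := e_lt _ _ uv.
  case: (leqP v y) => vy; first lia.
  case: (leqP u y) => // uy.
  case: (eqVneq u a) => [uEa|una].
    by have := ymax v; rewrite /Q -uEa uv orbT; lia.
  have eay : e a y.
    by case/orP: Qy => // /eqP yEa; lia.
  case: (eqVneq u y) => [uEy|uny].
    by case: (alt a y v) => //; rewrite -uEy.
  by case: (nc a u y v) => //; lia.
(* k is the largest neighbour of a below b, or a itself if there is none; the left subtree ends at
   k. *)
pose Q y := (a <= y < b) && ((y == a) || e a y).
have exQ : exists y, Q y by exists a; rewrite /Q eqxx /b; lia.
have ubQ y : Q y -> y <= b by case/andP; lia.
case: (ex_maxnP exQ ubQ) => k /andP[kb Qk] kmax.
(* An edge leaving [a, k] to the right ends at b if it starts at a, by maximality of k; it violates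
   alternation at k if it starts at k, and crosses (a, k) if it starts in between. *)
have cross u v : a <= u -> v <= b -> u <= k -> k < v -> e u v -> u = a /\ v = b.
  move=> ua vb uk kv uv.
  case: (eqVneq u a) => [uEa|una].
    case: (eqVneq v b) => // vnb.
    by have := kmax v; rewrite /Q -uEa uv orbT; lia.
  have eak : e a k by case/orP: Qk => // /eqP; lia.
  case: (eqVneq u k) => [uEk|unk].
    by case: (alt a k v) => //; rewrite -uEk.
  by case: (nc a u k v) => //; lia.
have conl : connected_on e a (a + (k - a)).
  move=> P HP u v Hu Hv.
  (* The extension by [P a] is constant along (a, b), the only edge that leaves the left
     interval. *)
  have := con (fun w => if w <= k then P w else P a).
  move=> /(_ _ u v); rewrite !ifT; try lia; apply; try lia.
  move=> x y xa yb xy; have xy1 := e_lt _ _ xy.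
  case: (leqP y k) => yk; first by rewrite ifT; [apply: HP => //; lia | lia].
  case: (leqP x k) => xk //.
  by have [-> _] := cross x y xa yb xk yk xy.
have conr : connected_on e k.+1 (k.+1 + (b - k.+1)).
  move=> P HP u v Hu Hv.
  have := con (fun w => if w <= k then P b else P w).
  move=> /(_ _ u v); rewrite !ifF; try lia; apply; try lia.
  move=> x y xa yb xy; have xy1 := e_lt _ _ xy.
  case: (leqP x k) => xk; last by rewrite ifF; [apply: HP => //; lia | lia].
  case: (leqP y k) => yk //.
  by have [_ ->] := cross x y xa yb xk yk xy.
have [|l sl El] := IH (k - a) _ a conl; first by lia.
have [|r sr Er] := IH (b - k.+1) _ k.+1 conr; first by lia.
exists (Node l r) => [/=|x y xa yb]; first by rewrite sl sr /b; lia.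
rewrite mem_edges_Node /= sl sr.
have -> : (a + (k - a)).+1 = k.+1 by lia.
have -> : a + (k - a + (b - k.+1)).+1 = b by lia.
case: (leqP y k) => yk.
  rewrite -El //; last by lia.
  have -> : ((x, y) == (a, b)) = false by apply/negP => /eqP[]; lia.
  have -> : ((x, y) \in edges r k.+1) = false; last by rewrite orbF.
  by apply/negP => /edges_bound; case/and3P; lia.
have -> : ((x, y) \in edges l a) = false.
  by apply/negP => /edges_bound; case/and3P; lia.
case: (leqP x k) => xk; last first.
  have -> : ((x, y) == (a, b)) = false by apply/negP => /eqP[]; lia.
  by rewrite -Er //; lia.
have -> : ((x, y) \in edges r k.+1) = false.
  by apply/negP => /edges_bound; case/and3P; lia.
rewrite !orbF; apply/idP/eqP => [xy|[-> ->] //].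
by have [-> ->] := cross x y xa yb xk yk xy.
Qed.

(** * Depth and parents in a tree *)

Section Tree.
Variables (n : nat) (E : {set {set 'I_n.+1}}).
Implicit Types x y z w : 'I_n.+1.

Lemma adj_sym x y : adj E x y = adj E y x.
Proof. by rewrite /adj /= setUC. Qed.

Lemma depth_path x (p : seq 'I_n.+1) :
  path (adj E) ord0 p -> last ord0 p = x -> depth E x <= size p.
Proof.
(* For a path with more than n edges the bound is immediate, since [depth] never exceeds its default
   value n.+1. *)
move=> pp px; case: (leqP (size p) n) => sp; last first.
  by apply: leq_trans sp; rewrite -[X in _ <= X](size_iota 0); exact: find_size.
rewrite leqNgt; apply/negP => /(before_find 0).
rewrite nth_iota ?ltnS // add0n => /existsP[]; exists (in_tuple p).
by rewrite pp px eqxx.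
Qed.

Hypothesis con : connected E.

(** A path without repeated vertices has at most n edges, so in a connected graph the default value
    of [depth] does not occur. *)
Lemma depth_leq_path x :
  exists p, [/\ path (adj E) ord0 p, last ord0 p = x, size p = depth E x
              & depth E x <= n].
Proof.
have : depth E x <= n.
  have /connectP[p0 /shortenP[p pp up _] ->] : connect (adj E) ord0 x.
    exact: (forallP (forallP con ord0) x).
  apply: leq_trans (depth_path pp erefl) _.
  by have := max_card (mem (ord0 :: p)); rewrite (card_uniqP up) card_ord.
move=> dn.
have hs : has (fun k => [exists w : k.-tuple 'I_n.+1,
               path (adj E) ord0 w && (last ord0 w == x)]) (iota 0 n.+1).
  by rewrite has_find size_iota ltnS.
have := nth_find 0 hs; rewrite -/(depth E x) nth_iota ?ltnS // add0n.
case/existsP=> p /andP[pp /eqP px].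
by exists p; split; rewrite ?size_tuple.
Qed.

Lemma depth_root : depth E ord0 = 0.
Proof. by apply/eqP; rewrite -leqn0; exact: (@depth_path _ [::]). Qed.

Lemma depth_adj x y : adj E x y -> depth E y <= (depth E x).+1.
Proof.
move=> xy; have [p [pp px <- _]] := depth_leq_path x.
by rewrite -(size_rcons p y); apply: depth_path; rewrite ?rcons_path ?pp ?px ?last_rcons.
Qed.

Lemma exists_parent y : y != ord0 -> exists x, parent E x y.
Proof.
move=> y0; have [p [pp py sp _]] := depth_leq_path y.
case/lastP: p => [|p x] in pp py sp *; first by rewrite -py eqxx in y0.
rewrite last_rcons in py; subst x; rewrite rcons_path size_rcons in pp sp.
have /andP[pp1 py] := pp; exists (last ord0 p); rewrite /parent /= py -sp ltnS.
exact: depth_path pp1 erefl.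
Qed.

Lemma parent_path x :
  exists p, [/\ path (parent E) ord0 p, last ord0 p = x & size p = depth E x].
Proof.
have [k dk] : exists k, depth E x = k by exists (depth E x).
elim: k x dk => [|k IH] x dk.
  have [p [_ px sp _]] := depth_leq_path x.
  by exists [::]; split=> //; rewrite -px (size0nil (etrans sp dk)).
have x0 : x != ord0 by apply/eqP => x0; rewrite x0 depth_root in dk.
have [y] := exists_parent x0; rewrite /parent /= => /andP[yx dy].
have dy1 : depth E y = k by have := depth_adj yx; lia.
have [p [pp py sp]] := IH _ dy1; exists (rcons p x).
by rewrite rcons_path pp py last_rcons size_rcons sp dy1 dk /parent /= yx dy.
Qed.

Lemma depth_leq x : depth E x <= n.
Proof. by have [p []] := depth_leq_path x. Qed.

(** Words are read from the root, but every vertex is reached from the root along parent edges, so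
    any parent edge ends such a path. As depths are at most n, the length bound in [contains] is
    met. *)
Lemma contains1P f s :
  reflect (exists x y, parent E x y /\ edge_step f x y = s) (contains E f [:: s]).
Proof.
apply: (iffP existsP) => [[k /existsP[p /andP[pp]]]|[x [y [xy st]]]].
  rewrite /word; move: (ord0) pp; elim: (tval p) => [|y q IH] x //=.
  case/andP=> xy yq; case/orP => [/andP[/eqP st _]|]; last exact: IH.
  by exists x, y.
have [p [pp px sp]] := parent_path x.
have dy : depth E y < n.+1 by rewrite ltnS depth_leq.
have dxy : depth E x < depth E y by case/andP: xy.
have dyx : depth E y <= (depth E x).+1 by apply: depth_adj; case/andP: xy.
have sq : size (rcons p y) == Ordinal dy by rewrite size_rcons sp /=; lia.
exists (Ordinal dy); apply/existsP; exists (Tuple sq) => /=.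
rewrite rcons_path pp px xy /= /word -cats1 pairmap_cat px /= st.
by apply/infixP; exists (pairmap (edge_step f) ord0 p), [::].
Qed.

Lemma contains2P f s t :
  reflect (exists x y z, [/\ parent E x y, parent E y z,
                             edge_step f x y = s & edge_step f y z = t])
          (contains E f [:: s; t]).
Proof.
apply: (iffP existsP) => [[k /existsP[p /andP[pp]]]|[x [y [z [xy yz st1 st2]]]]].
  rewrite /word; move: (ord0) pp; elim: (tval p) => [|y [|z q] IH] x //=.
    by rewrite andbF.
  case/andP=> xy yzq; case/orP => [|]; last exact: IH.
  case/andP: yzq => yz _ /and3P[/eqP st1 /eqP st2 _].
  by exists x, y, z.
have [p [pp px sp]] := parent_path x.
have dz : depth E z < n.+1 by rewrite ltnS depth_leq.
have dxy : depth E x < depth E y by case/andP: xy.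
have dyx : depth E y <= (depth E x).+1 by apply: depth_adj; case/andP: xy.
have dyz : depth E y < depth E z by case/andP: yz.
have dzy : depth E z <= (depth E y).+1 by apply: depth_adj; case/andP: yz.
have sq : size (p ++ [:: y; z]) == Ordinal dz by rewrite size_cat sp /=; lia.
exists (Ordinal dz); apply/existsP; exists (Tuple sq) => /=.
rewrite cat_path pp px /= xy yz /= /word pairmap_cat px /= st1 st2.
by apply/infixP; exists (pairmap (edge_step f) ord0 p), [::].
Qed.

Hypotheses (simp : simple_graph E) (acyc : acyclic E).

Lemma adj_neq x y : adj E x y -> x != y.
Proof.
move=> xy; have := forallP simp [set x; y]; rewrite (xy : _ \in _) cards2.
by case: (x == y).
Qed.

(** Two distinct neighbours of x that are not deeper than x can both be reached from the root while
    avoiding x; joining them through x closes a cycle. *)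
Lemma adj_lower_uniq x y y' : adj E x y -> adj E x y' ->
  depth E y <= depth E x -> depth E y' <= depth E x -> y = y'.
Proof.
move=> xy xy' dy dy'; apply/eqP/negP => /negP yy'.
pose e := [rel u v | [&& adj E u v, u != x & v != x]].
have e_sym : connect_sym e.
  by apply: sym_connect_sym => u v /=; rewrite adj_sym [X in _ && X]andbC.
(* On the path of parents to z every earlier vertex is less deep than z, hence less deep than x. *)
have avoid z : adj E x z -> depth E z <= depth E x -> connect e ord0 z.
  move=> xz dz; have [p [pp pz _]] := parent_path z.
  have below u q : path (parent E) u q -> forall w, w \in u :: q ->
      w = last u q \/ depth E w < depth E (last u q).
    elim: q u => [|v q IHq] u /=; first by move=> _ w; rewrite inE => /eqP; left.
    case/andP=> /andP[_ duv] vq w; rewrite inE => /orP[/eqP-> |]; last exact: IHq.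
    right; apply: (leq_trans duv).
    by have [<-|/ltnW] := IHq _ vq _ (mem_head v q).
  have px w : w \in ord0 :: p -> w != x.
    move/(below _ _ pp); rewrite pz => -[->|dw].
      by rewrite eq_sym adj_neq.
    by apply: contraTneq dw => ->; rewrite -leqNgt.
  apply/connectP; exists p => //; move: pp px {pz}.
  elim: p (ord0) => //= v q IHq u /andP[/andP[uv _] vq] px.
  rewrite uv !px ?inE ?eqxx ?orbT //=; apply: IHq => // w wq.
  by apply: px; rewrite inE wq orbT.
have : connect e y y'.
  by apply: connect_trans (avoid y' xy' dy'); rewrite e_sym; exact: avoid.
case/connectP=> p0 /shortenP[p pp up _] py'.
have p0' : p != [::] by apply: contraNneq yy' => p0'; rewrite py' p0'.
have xp : x \notin y :: p.
  rewrite inE negb_or (adj_neq xy) /=.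
  elim: p (y) pp {up py' p0'} => //= v q IHq u /andP[/and3P[_ _ vx] vq].
  by rewrite inE negb_or eq_sym vx; exact: IHq vq.
have adjp : path (adj E) y p by apply: sub_path pp => u v /and3P[].
(* Since p is nonempty, this cycle has at least three vertices. *)
have /acyclicP/(_ (x :: y :: p)) := acyc; rewrite /ucycle /= xy -/(uniq (y :: p)) up.
rewrite rcons_path adjp -py' /= adj_sym xy' xp => /(_ isT).
by case: (p) p0'.
Qed.

(** If adjacent x and y had equal depth, then y and the parent of x would be two neighbours of x not
    deeper than x, hence equal, although the parent is strictly less deep. *)
Lemma parent_total x y : adj E x y -> parent E x y || parent E y x.
Proof.
move=> xy; rewrite /parent /= (adj_sym y) xy /=.
case: ltngtP => // dxy; have x0 : x != ord0.
  apply/eqP => x0; have [p [_ py sp _]] := depth_leq_path y.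
  move: sp (adj_neq xy); rewrite -dxy x0 depth_root => /size0nil p0.
  by rewrite -py p0 eqxx.
have [w /andP[wx dw]] := exists_parent x0.
have yw : y = w by apply: (@adj_lower_uniq x); rewrite ?dxy // ?(adj_sym x) // -dxy ltnW.
by move: dw; rewrite -yw dxy ltnn.
Qed.

End Tree.

(** * Alternation as a local condition at each vertex *)

Definition vertex_alternating n (E : {set {set 'I_n.+1}}) :=
  forall x y z : 'I_n.+1, x < y -> y < z -> adj E x y -> adj E y z -> False.

Definition level_free n (E : {set {set 'I_n.+1}}) (f : {ffun 'I_n.+1 -> 'I_n.+2}) :=
  [forall x, forall y, adj E x y ==> (f x != f y)].

Lemma level_freeP n (E : {set {set 'I_n.+1}})
    (f : {ffun 'I_n.+1 -> 'I_n.+2}) :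
  reflect (forall x y, adj E x y -> f x != f y) (level_free E f).
Proof.
apply: (iffP forallP) => [H x y|H x]; first by have /forallP/(_ y)/implyP := H x.
by apply/forallP => y; apply/implyP; exact: H.
Qed.

Section Steps.
Variables (n : nat) (f : {ffun 'I_n.+1 -> 'I_n.+2}) (x y : 'I_n.+1).

Lemma edge_step_asc : (edge_step f x y == asc) = (f x < f y).
Proof. by rewrite /edge_step; do 2?case: ifP. Qed.

Lemma edge_step_lev : (edge_step f x y == lev) = (f x == f y).
Proof. by rewrite /edge_step -!(inj_eq val_inj (f x)) /=; case: ltngtP. Qed.

Lemma edge_step_des : (edge_step f x y == des) = (f y < f x).
Proof. by rewrite /edge_step -!(inj_eq val_inj (f x)) /=; case: ltngtP. Qed.

End Steps.

(** With monotone labels and no level, an ascent is a step to a larger index. If y has neighbours on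
    both sides, it is not the root; a neighbour on the side away from its parent is a child, which
    yields two consecutive ascents or two consecutive descents. *)
Lemma alternatingP n (E : {set {set 'I_n.+1}})
    (f : {ffun 'I_n.+1 -> 'I_n.+2}) :
  is_tree E -> (forall i j : 'I_n.+1, i <= j -> f i <= f j) ->
  reflect (vertex_alternating E /\ level_free E f) (alternating E f).
Proof.
case/and3P=> simp con acyc mono.
have mono_lt x y : f x < f y -> x < y.
  by move=> fxy; rewrite ltnNge; apply: contraL fxy => /mono; rewrite -leqNgt.
apply: (iffP idP) => [|[va /level_freeP pr]]; last first.
  apply/and3P; split; apply/negP.
  - case/(contains2P con) => x [y [z [/andP[xy _] /andP[yz _] /eqP st1 /eqP st2]]].
    rewrite !edge_step_asc in st1 st2.
    by apply: (va x y z) => //; exact: mono_lt.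
  - case/(contains2P con) => x [y [z [/andP[xy _] /andP[yz _] /eqP st1 /eqP st2]]].
    rewrite !edge_step_des in st1 st2.
    by apply: (va z y x); [exact: mono_lt | exact: mono_lt | rewrite adj_sym | rewrite adj_sym].
  - case/(contains1P con) => x [y [/andP[xy _] /eqP]].
    by rewrite edge_step_lev; apply/negP/pr.
case/and3P=> /negP uu /negP dd /negP h.
have pr x y : adj E x y -> f x != f y.
  move=> xy; apply/negP => fxy; apply: h; apply/(contains1P con).
  case/orP: (parent_total con simp acyc xy) => pxy; [exists x, y | exists y, x];
    by split=> //; apply/eqP; rewrite edge_step_lev // eq_sym.
split; last by apply/level_freeP.
have mono_adj (x y : 'I_n.+1) : x < y -> adj E x y -> f x < f y.
  by move=> xy /pr; rewrite -val_eqE ltn_neqAle /= => ->; rewrite mono // ltnW.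
have no_uu (x y z : 'I_n.+1) : x < y -> y < z -> parent E x y -> parent E y z -> False.
  move=> xy yz pxy pyz; apply: uu; apply/(contains2P con).
  exists x, y, z; split=> //; apply/eqP; rewrite edge_step_asc mono_adj //;
    by [case/andP: pxy | case/andP: pyz].
have no_dd (x y z : 'I_n.+1) : x < y -> y < z -> parent E z y -> parent E y x -> False.
  move=> xy yz pzy pyx; apply: dd; apply/(contains2P con).
  exists z, y, x; split=> //; apply/eqP; rewrite edge_step_des mono_adj //;
    rewrite adj_sym; by [case/andP: pzy | case/andP: pyx].
move=> x y z xy yz exy eyz.
have [w wE] : exists w, parent E w y by apply: exists_parent => //; apply: contraTneq xy => ->.
have [wy dw] := andP wE; have := adj_neq simp wy; rewrite -val_eqE neq_ltn /=.
have up v : adj E y v -> v != w -> parent E y v.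
  move=> yv vw; case/orP: (parent_total con simp acyc yv) => // /andP[_ dv].
  by case/eqP: vw; apply: (adj_lower_uniq con simp acyc (x := y)) => //;
    rewrite 1?adj_sym // ltnW.
case/orP=> wy_lt.
  by apply: (no_uu w y z) => //; apply: up => //; rewrite -val_eqE /=; lia.
apply: (no_dd x y w) => //; apply: up; rewrite 1?adj_sym // -val_eqE /=; lia.
Qed.

(** An ascent is determined by its upper end, parents being unique. Conversely, if a vertex has a
    smaller neighbour, alternation puts its parent on that side too, so the edge from the parent is
    an ascent. *)
Lemma ascents_tree n (E : {set {set 'I_n.+1}})
    (f : {ffun 'I_n.+1 -> 'I_n.+2}) :
  is_tree E -> (forall i j : 'I_n.+1, i <= j -> f i <= f j) ->
  vertex_alternating E -> level_free E f ->
  ascents E f = #|[set y : 'I_n.+1 | [exists x : 'I_n.+1, (x < y) && adj E x y]]|.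
Proof.
case/and3P=> simp con acyc mono va /level_freeP pr.
have mono_lt x y : f x < f y -> x < y.
  by move=> fxy; rewrite ltnNge; apply: contraL fxy => /mono; rewrite -leqNgt.
rewrite /ascents -(card_in_imset (f := snd)); last first.
  move=> [x y] [x' y']; rewrite !inE /= => /andP[/andP[xy dx] _] /andP[/andP[xy' dx'] _] yy'.
  rewrite -yy' in xy' dx' *; congr (_, _).
  by apply: (adj_lower_uniq con simp acyc (x := y)); rewrite 1?adj_sym // ltnW.
congr #|pred_of_set _|; apply/setP => y; rewrite inE.
apply/imsetP/existsP => [[[u v]]|[x /andP[xy exy]]].
  rewrite inE edge_step_asc /= => /andP[/andP[uv _] fuv] ->.
  by exists u; rewrite uv mono_lt.
have [w wE] : exists w, parent E w y by apply: exists_parent => //; apply: contraTneq xy => ->.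
exists (w, y) => //; rewrite inE /= wE edge_step_asc.
have [wy dw] := andP wE; have := adj_neq simp wy; rewrite -val_eqE neq_ltn /=.
case/orP=> wy_lt; last by case: (va x y w) => //; rewrite adj_sym.
by have := pr _ _ wy; rewrite -val_eqE ltn_neqAle /= => ->; rewrite mono // ltnW.
Qed.

(** * Acyclicity of non-crossing alternating graphs *)

(** The successor and the predecessor of x on a cycle with at least three vertices are distinct, so
    one of them differs from y. *)
Lemma ucycle_other_neighbour (T : eqType) (e : rel T) (c : seq T) (x y : T) :
  symmetric e -> ucycle e c -> 2 < size c -> x \in c ->
  exists z, [/\ z \in c, z != y & e x z].
Proof.
move=> e_sym /andP[ec uc] sc /rot_to[i c' rc].
have memc z : (z \in c) = (z \in x :: c') by rewrite -rc mem_rot.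
move: ec uc sc; rewrite -(rot_cycle i) -(rot_uniq i) -(size_rot i) rc.
case: c' => [|z c'] // in rc memc *; case/lastP: c' => [|p z'] // in rc memc *.
rewrite /= rcons_path last_rcons mem_rcons inE.
case/andP=> xz /andP[_ z'x] /and3P[_ zz' _] _.
case: (eqVneq z y) => [zy|]; last by exists z; rewrite memc !inE eqxx orbT.
exists z'; rewrite memc !inE mem_rcons inE eqxx !orbT e_sym z'x; split=> //.
by rewrite -zy; apply: contra zz' => /eqP->; rewrite mem_head.
Qed.

(* A shortest edge (x, y) of a cycle is crossed: the other neighbour of y on
   the cycle lies below x, and the other neighbour of x lies above y. *)
Lemma nc_alternating_acyclic n (E : {set {set 'I_n.+1}}) :
  simple_graph E -> non_crossing E -> vertex_alternating E -> acyclic E.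
Proof.
move=> simp nc va; apply/acyclicP => c ucc; rewrite leqNgt; apply/negP => sc.
have other x y := @ucycle_other_neighbour _ _ c x y (@adj_sym n E) ucc sc.
pose P (p : 'I_n.+1 * 'I_n.+1) := [&& p.1 \in c, p.2 \in c, adj E p.1 p.2 & p.1 < p.2].
have [p0 Pp0] : exists p, P p.
  have [x xc] : exists x, x \in c.
    by case: (c) sc => // x c' _; exists x; rewrite mem_head.
  have [z [zc zx xz]] := other x x xc.
  move: zx; rewrite -val_eqE neq_ltn => /orP[zx|xz'].
    by exists (z, x); rewrite /P zc xc adj_sym xz.
  by exists (x, z); rewrite /P zc xc xz.
have := @arg_minnP _ p0 P (fun p => p.2 - p.1) Pp0.
case=> -[x y] /and4P[/= xc yc exy xy] min.
have [y' [y'c y'y exy']] := other x y xc.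
have [x' [x'c x'x eyx']] := other y x yc.
have x'y' := adj_neq simp eyx'; have xy'' := adj_neq simp exy'.
rewrite -!val_eqE /= in x'y' xy'' x'x y'y.
have lt1 : x' < y.
  rewrite ltnNge; apply/negP => yx'; apply: (va x y x') => //; lia.
have lt2 : x < y'.
  rewrite ltnNge; apply/negP => yx'; apply: (va y' x y) => //; first lia.
  by rewrite adj_sym.
have := min (x', y); rewrite /P /= x'c yc adj_sym eyx' lt1 => /(_ isT) m1.
have := min (x, y'); rewrite /P /= xc y'c exy' lt2 => /(_ isT) m2.
have /forallP/(_ x)/forallP/(_ y)/forallP/(_ y') := forallP nc x'.
move/implyP; rewrite (adj_sym E x') eyx' exy' /= => H; suff : false by [].
by apply: H; lia.
Qed.

(** * Non-crossing alternating trees as binary trees *)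

Definition edgeset n t : {set {set 'I_n.+1}} :=
  [set [set p.1; p.2] | p : 'I_n.+1 * 'I_n.+1
     in [pred p | (val p.1, val p.2) \in edges t 0]].

Lemma set2_inj (T : finType) (x y u v : T) : x != y ->
  [set x; y] = [set u; v] -> (x = u /\ y = v) \/ (x = v /\ y = u).
Proof.
move=> xy /setP eq_uv; have := eq_uv x; have := eq_uv y.
rewrite !inE !eqxx orbT /= => /esym/orP[]/eqP ey /esym/orP[]/eqP ex;
  by [right | left | rewrite ex ey eqxx in xy].
Qed.

Lemma adj_edgeset n t (x y : 'I_n.+1) :
  adj (edgeset n t) x y =
  ((val x, val y) \in edges t 0) || ((val y, val x) \in edges t 0).
Proof.
apply/imsetP/orP => [[[u v]]|[xy|yx]]; last 2 first.
- by exists (x, y).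
- by exists (y, x) => //=; rewrite setUC.
rewrite inE /= => uv /esym; have /and3P[_ ltuv _] := edges_bound uv.
have neuv : u != v by rewrite neq_ltn /= ltuv.
by case/(set2_inj neuv) => -[<- <-]; rewrite uv; [left | right].
Qed.

Lemma simple_edgeset n t : simple_graph (edgeset n t).
Proof.
apply/forallP => e; apply/implyP => /imsetP[[u v]].
rewrite inE /= => /edges_bound/and3P[_ uv _] ->.
by rewrite cards2 neq_ltn /= uv.
Qed.

Lemma edgeset_lt n t (x y : 'I_n.+1) :
  x < y -> adj (edgeset n t) x y = ((val x, val y) \in edges t 0).
Proof.
move=> xy; rewrite adj_edgeset orbC (_ : (_ \in _) = false) //.
by apply/negP => /edges_bound /=; lia.
Qed.

Lemma edgeset_nc n t : non_crossing (edgeset n t).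
Proof.
apply/forallP => a; apply/forallP => b; apply/forallP => c; apply/forallP => d.
apply/implyP => /and3P[ab bc cd]; rewrite !edgeset_lt; [|exact: ltn_trans cd|exact: ltn_trans bc].
by apply/negP => /andP[ac bd]; apply: edges_nc ac bd ab bc cd.
Qed.

Lemma edgeset_alternating n t : vertex_alternating (edgeset n t).
Proof.
by move=> x y z xy yz; rewrite !edgeset_lt // => xy' yz'; exact: edges_alt xy' yz'.
Qed.

Lemma edgeset_connected n t : nedges t = n -> connected (edgeset n t).
Proof.
move=> tn; apply/forallP => x; apply/forallP => y.
have xn := ltn_ord x; have yn := ltn_ord y.
pose P i := connect (adj (edgeset n t)) x (inord i).
have := @edges_connected t 0 P; rewrite tn => /(_ _ x y).
rewrite /P !inord_val connect0 => <- //; try lia.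
move=> i j _ jn ij; have /and3P[_ lt_ij _] := edges_bound ij.
have iK : @inord n i = i :> nat by rewrite inordK //; lia.
have jK : @inord n j = j :> nat by rewrite inordK //; lia.
apply/idP/idP => xi; apply: (connect_trans xi); apply: connect1;
  by rewrite adj_edgeset /= iK jK ij ?orbT.
Qed.

Lemma edgeset_tree n t : nedges t = n -> is_tree (edgeset n t).
Proof.
move=> tn; rewrite /is_tree simple_edgeset edgeset_connected //=.
apply: nc_alternating_acyclic;
  [exact: simple_edgeset | exact: edgeset_nc | exact: edgeset_alternating].
Qed.

Lemma edgeset_inj n s t :
  nedges s = n -> nedges t = n -> edgeset n s = edgeset n t -> s = t.
Proof.
move=> sn tn st; apply: (@edges_inj _ _ 0) => [|[x y]]; first by rewrite sn.
have bnd u : nedges u = n -> (x, y) \in edges u 0 -> x < y <= n.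
  by move=> un /edges_bound; rewrite un; lia.
case: (boolP (x < y <= n)) => xy; last first.
  by apply/idP/idP => /bnd => [/(_ sn)|/(_ tn)] H; rewrite H in xy.
have xn : x < n.+1 by lia.
have yn : y < n.+1 by lia.
have lt_xy : Ordinal xn < Ordinal yn by case/andP: xy.
by have := edgeset_lt s lt_xy; rewrite st edgeset_lt.
Qed.

Lemma tree_edgeset n (E : {set {set 'I_n.+1}}) :
  is_tree E -> non_crossing E -> vertex_alternating E ->
  exists2 t, nedges t = n & E = edgeset n t.
Proof.
case/and3P=> simp con _ nc va.
(* The bounds keep [inord] away from its default value. *)
pose e i j := [&& i < j, j <= n & adj E (inord i) (inord j)].
have eE (x y : 'I_n.+1) : e x y = (x < y) && adj E x y.
  by rewrite /e !inord_val leq_ord.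
have [i j||||t tn et] := @alt_nc_connected_edges e 0 n.
- by case/and3P.
- move=> x x' y y' /and3P[xy yn exy] /and3P[xy' yn' exy'] lt1 lt2 lt3.
  have /forallP/(_ (inord x'))/forallP/(_ (inord y))/forallP/(_ (inord y')) :=
    forallP nc (inord x).
  rewrite exy exy' !inordK ?lt1 ?lt2 ?lt3 //; lia.
- move=> x y z /and3P[xy yn exy] /and3P[yz zn eyz].
  by apply: (va (inord x) (inord y) (inord z)); rewrite ?inordK //; lia.
- move=> P HP u v Hu Hv.
  have un : u < n.+1 by lia.
  have vn : v < n.+1 by lia.
  have cl : closed (adj E) [pred x : 'I_n.+1 | P x].
    move=> x y xy; rewrite !inE; have := adj_neq simp xy.
    rewrite -val_eqE neq_ltn /= => /orP[lt|lt].
      by apply: HP => //; rewrite ?leq_ord // eE lt.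
    by apply/esym/HP; rewrite ?leq_ord // eE lt adj_sym.
  exact: (closed_connect cl (forallP (forallP con (Ordinal un)) (Ordinal vn))).
have adjE x y : adj E x y = adj (edgeset n t) x y.
  have lt_case (u v : 'I_n.+1) : u < v -> adj E u v = adj (edgeset n t) u v.
    move=> uv; have := et u v isT; rewrite add0n leq_ord => /(_ isT).
    by rewrite eE uv edgeset_lt.
  case: (ltngtP x y) => xy; first exact: lt_case.
    by rewrite adj_sym lt_case // adj_sym.
  move/val_inj: xy => ->; apply/idP/idP.
    by move/(adj_neq simp); rewrite eqxx.
  by move/(adj_neq (simple_edgeset n t)); rewrite eqxx.
exists t => //; apply/setP => f.
have sg := simple_edgeset n t.
apply/idP/idP => fE.
  have /implyP/(_ fE)/cards2P[x [y [_ fxy]]] := forallP simp f.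
  have : adj E x y by rewrite /adj /= -fxy.
  by rewrite adjE /adj /= -fxy.
have /implyP/(_ fE)/cards2P[x [y [_ fxy]]] := forallP sg f.
have : adj (edgeset n t) x y by rewrite /adj /= -fxy.
by rewrite -adjE /adj /= -fxy.
Qed.

(** * Labellings *)

Section Labellings.
Variable n : nat.
Implicit Types (f : {ffun 'I_n.+1 -> 'I_n.+2}) (A : {set 'I_n}) (i : 'I_n).

Definition lpt i : 'I_n.+1 := widen_ord (leqnSn n) i.
Definition rpt i : 'I_n.+1 := lift ord0 i.

Definition jumps f : {set 'I_n} := [set i | f (lpt i) < f (rpt i)].

Definition labelling_of A : {ffun 'I_n.+1 -> 'I_n.+2} :=
  [ffun x : 'I_n.+1 => inord (\sum_(j < n) ((j \in A) && (j < x))).+1].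

Lemma is_labelling_mono f : is_labelling f ->
  forall x y : 'I_n.+1, x <= y -> f x <= f y.
Proof.
by case/and3P=> /forallP mono _ _ x y xy; have /forallP/(_ y)/implyP := mono x; exact.
Qed.

(** A weakly increasing sequence starting at 1 takes all values of an initial segment exactly when
    it never rises by more than one. *)
Lemma is_labellingP f :
  reflect (f ord0 = 1 :> nat /\ forall i, f (rpt i) = f (lpt i) + (i \in jumps f) :> nat)
          (is_labelling f).
Proof.
apply: (iffP idP) => [lab | [f0 fS]].
  have mono := is_labelling_mono lab.
  case/and3P: lab => _ /eqP f0 /existsP[m /eqP/setP im]; split=> // i.
  have lr : f (lpt i) <= f (rpt i) by apply: mono; rewrite /= /bump /=; lia.
  rewrite inE; case: ltnP => h; last by lia.
  apply/eqP; rewrite addn1 eqn_leq h andbT leqNgt; apply/negP => h2.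
  have fm : f (rpt i) <= m.
    by have := im (f (rpt i)); rewrite !inE imset_f // => /esym/andP[].
  (* After a rise by two or more, the value just above [f (lpt i)] would be the label of some j;
     monotonicity excludes j on either side of the gap. *)
  have vb : (f (lpt i)).+1 < n.+2 by apply: ltn_trans h2 _; exact: ltn_ord.
  have := im (Ordinal vb); rewrite !inE /= (_ : _ < m); last by lia.
  case/imsetP => j _ /(congr1 val) /= fj.
  case: (leqP j i) => ji.
    by have := @mono j (lpt i) ji; rewrite -fj ltnn.
  have rj : rpt i <= j by rewrite /= /bump /=; lia.
  by have := mono _ _ rj; rewrite -fj leqNgt h2.
have mono d : forall x y (xn : x < n.+1) (yn : y < n.+1), y = x + d ->
    f (Ordinal xn) <= f (Ordinal yn).
  elim: d => [|d IH] x y xn yn xy.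
    by rewrite (_ : Ordinal xn = Ordinal yn) //; apply: val_inj; rewrite /= xy addn0.
  case: y => [|y] in yn xy *; first by lia.
  have yn' : y < n by [].
  apply: leq_trans (IH x y xn (ltnW yn) _) _; first by lia.
  have := fS (Ordinal yn'); rewrite (_ : rpt _ = Ordinal yn); last exact: val_inj.
  by rewrite (_ : lpt _ = Ordinal (ltnW yn)) => [->|]; [exact: leq_addr | exact: val_inj].
have monoI (x y : 'I_n.+1) : x <= y -> f x <= f y.
  by case: x y => x xn [y yn] /= xy; apply: (mono (y - x)); lia.
apply/and3P; split; last 1 first.
- apply/existsP; exists (f ord_max); apply/eqP/setP => l; rewrite inE.
  apply/imsetP/andP => [[x _ ->]|[l1 lm]].
    by rewrite -f0 !monoI //= -ltnS.
  (* Discrete intermediate value property, by induction on the position k. *)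
  have hit k (kn : k < n.+1) : l <= f (Ordinal kn) -> exists x, l = f x.
    elim: k kn => [|k IH] kn lk.
      rewrite (_ : Ordinal kn = ord0) ?f0 in lk; last exact: val_inj.
      by exists ord0; apply: val_inj; rewrite /= f0; apply/eqP; rewrite eqn_leq lk.
    have kn' : k < n by [].
    case: (leqP l (f (Ordinal (ltnW kn)))) => [/IH //|lk'].
    exists (Ordinal kn); apply: val_inj; apply/eqP; rewrite eqn_leq lk /=.
    have := fS (Ordinal kn'); rewrite (_ : rpt _ = Ordinal kn); last exact: val_inj.
    rewrite (_ : lpt _ = Ordinal (ltnW kn)) => [->|]; last exact: val_inj.
    by case: (_ \in _); rewrite ?addn1 ?addn0 // ltnW.
  by have [x ->] := hit _ _ lm; exists x.
- by apply/forallP => x; apply/forallP => y; apply/implyP; exact: monoI.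
- by rewrite f0.
Qed.

(** There are at most n jumps, so the label stays below n.+2 and [inord] is exact. *)
Lemma labelling_ofE A (x : 'I_n.+1) :
  labelling_of A x = (\sum_(j < n) ((j \in A) && (j < x))).+1 :> nat.
Proof.
rewrite ffunE inordK // !ltnS -[X in _ <= X]card_ord -sum1_card.
by apply: leq_sum => j _; exact: leq_b1.
Qed.

Lemma labelling_of_root A : labelling_of A ord0 = 1 :> nat.
Proof. by rewrite labelling_ofE big1 // => j _; rewrite ltn0 andbF. Qed.

Lemma labelling_ofS A i :
  labelling_of A (rpt i) = labelling_of A (lpt i) + (i \in A) :> nat.
Proof.
rewrite !labelling_ofE addSn; congr _.+1.
rewrite (bigD1 i) //= [in RHS](bigD1 i) //= ltnn andbF /bump /= add1n ltnSn andbT addnC.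
congr (_ + _); apply: eq_bigr => j; rewrite -val_eqE /= => ji.
by rewrite ltnS leq_eqVlt (negPf ji).
Qed.

Lemma labelling_ofK A : jumps (labelling_of A) = A.
Proof.
by apply/setP => i; rewrite inE labelling_ofS; case: (i \in A); rewrite ?addn1 ?addn0 ?ltnn ?ltnSn.
Qed.

Lemma labelling_ofP A : is_labelling (labelling_of A).
Proof.
by apply/is_labellingP; split=> [|i]; rewrite ?labelling_of_root // labelling_ofK labelling_ofS.
Qed.

Lemma jumpsK f : is_labelling f -> labelling_of (jumps f) = f.
Proof.
case/is_labellingP=> f0 fS; apply/ffunP => -[x xn]; apply: val_inj => /=.
elim: x xn => [|x IH] xn.
  by rewrite (_ : Ordinal xn = ord0) ?labelling_of_root ?f0 //; exact: val_inj.
have xn' : x < n by [].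
rewrite (_ : Ordinal xn = rpt (Ordinal xn')); last exact: val_inj.
rewrite labelling_ofS fS; congr (_ + _).
rewrite (_ : lpt _ = Ordinal (ltnW xn)); last exact: val_inj.
exact: IH.
Qed.

(** Complementation turns the supersets of S into the subsets of its complement. *)
Lemma card_supersets (T : finType) (S : {set T}) :
  #|[set A : {set T} | S \subset A]| = 2 ^ (#|T| - #|S|).
Proof.
have -> : #|T| - #|S| = #|~: S| by rewrite [RHS]cardsCs setCK.
rewrite -card_powerset -(card_imset (mem (powerset (~: S))) (@setC_inj T)).
congr #|pred_of_set _|; apply/setP => A; rewrite inE; apply/idP/imsetP => [SA | [B]].
  by exists (~: A); rewrite ?setCK // inE setCS.
by rewrite inE => BS ->; rewrite -setCS setCK.
Qed.

Lemma card_labellings_jumps (S : {set 'I_n}) :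
  #|[set f | is_labelling f && (S \subset jumps f)]| = 2 ^ (n - #|S|).
Proof.
rewrite -[X in X - _]card_ord -card_supersets.
rewrite -(card_imset (mem [set A : {set 'I_n} | S \subset A]) (can_inj labelling_ofK)).
congr #|pred_of_set _|; apply/setP => f; rewrite inE; apply/andP/imsetP => [[lab Sf]|[A]].
  by exists (jumps f); rewrite ?inE ?jumpsK.
by rewrite inE => SA ->; rewrite labelling_ofP labelling_ofK.
Qed.

End Labellings.

(** * Edges between consecutive points, and points with a smaller neighbour *)

(** The root edge spans the root edge of any nonempty subtree; if both subtrees are leaves, it joins
    consecutive points itself. *)
Lemma edges_short t a x y : (x, y) \in edges t a ->
  exists i, [/\ x <= i, i < y & (i, i.+1) \in edges t a].
Proof.
elim: t a x y => [|l IHl r IHr] a x y //; rewrite mem_edges_Node.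
have root u v b : u = Node v b -> forall c, (c, c + nedges u) \in edges u c.
  by move=> -> c; rewrite mem_edges_Node eqxx.
case/or3P=> [/eqP[-> ->]|/IHl[i [xi iy H]]|/IHr[i [xi iy H]]]; last 2 first.
- by exists i; rewrite mem_edges_Node H orbT.
- by exists i; rewrite mem_edges_Node H !orbT.
case: l IHl => [|l1 l2] IHl.
  case: r IHr => [|r1 r2] IHr.
    have E : a + nedges (Node Leaf Leaf) = a.+1 by rewrite /=; lia.
    by exists a; rewrite mem_edges_Node E eqxx.
  have [i [xi iy H]] := IHr _ _ _ (root (Node r1 r2) _ _ erefl (a + nedges Leaf).+1).
  by exists i; rewrite mem_edges_Node H !orbT; split=> //; simpl in *; lia.
have [i [xi iy H]] := IHl _ _ _ (root (Node l1 l2) _ _ erefl a).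
by exists i; rewrite mem_edges_Node H orbT; split=> //; simpl in *; lia.
Qed.

(** Each edge spans an edge between consecutive points, and a jump there makes the labels of its
    ends differ by monotonicity. *)
Lemma level_free_edgeset n t (f : {ffun 'I_n.+1 -> 'I_n.+2}) : is_labelling f ->
  level_free (edgeset n t) f =
  ([set i : 'I_n | (val i, i.+1) \in edges t 0] \subset jumps f).
Proof.
move=> lab; have mono := is_labelling_mono lab.
apply/level_freeP/subsetP => [pr i|short x y].
  rewrite !inE => ei; have := pr (lpt i) (rpt i).
  rewrite adj_edgeset /= /bump /= add1n ei -val_eqE /= => /(_ isT) ne.
  by rewrite ltn_neqAle ne mono //= /bump /=; lia.
have lt_case (u v : 'I_n.+1) : (val u, val v) \in edges t 0 -> f u < f v.
  move=> /edges_short[k [uk kv ek]].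
  have kn : k < n by have := ltn_ord v; simpl in *; lia.
  have := short (Ordinal kn); rewrite !inE => /(_ ek) ltf.
  by apply: leq_trans (leq_ltn_trans _ ltf) _; apply: mono; rewrite /= /bump /=; simpl in *; lia.
by rewrite adj_edgeset -val_eqE neq_ltn /= => /orP[/lt_case ->|/lt_case ->]; rewrite ?orbT.
Qed.

(** Number of edges joining consecutive points: the root edge is one of them only if both subtrees
    are single points. *)
Fixpoint nshort t :=
  if t is Node l r then nshort l + nshort r + (is_leaf l && is_leaf r) else 0.

(** Number of points with a smaller neighbour. The root edge makes the last point one of them; if
    [r] is not a leaf, [nmaxima r] has already counted it. *)
Fixpoint nmaxima t :=
  if t is Node l r then nmaxima l + (if is_leaf r then 1 else nmaxima r) else 0.

Lemma nshortE t a :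
  \sum_(a <= i < a + nedges t) ((i, i.+1) \in edges t a) = nshort t.
Proof.
elim: t a => [|l IHl r IHr] a; first by rewrite big_geq //= addn0.
have leaf0 t : (nedges t == 0) = is_leaf t by case: t.
pose F i := ((i, i.+1) \in edges (Node l r) a : nat).
have Fl i : a <= i < a + nedges l -> F i = ((i, i.+1) \in edges l a).
  move=> Hi; rewrite /F mem_edges_Node.
  have -> : ((i, i.+1) \in edges r (a + nedges l).+1) = false.
    by apply/negP => /edges_bound; lia.
  have -> : ((i, i.+1) == (a, a + nedges (Node l r))) = false.
    by apply/negP => /eqP[] /=; lia.
  by rewrite orbF.
have Fr i : a + nedges l < i -> F i = ((i, i.+1) \in edges r (a + nedges l).+1).
  move=> Hi; rewrite /F mem_edges_Node.
  have -> : ((i, i.+1) \in edges l a) = false.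
    by apply/negP => /edges_bound; lia.
  have -> // : ((i, i.+1) == (a, a + nedges (Node l r))) = false.
  by apply/negP => /eqP[] /=; lia.
(* Only the root edge can join the two points on either side of the gap between the subtrees. *)
have Fm : F (a + nedges l) = is_leaf l && is_leaf r.
  rewrite /F mem_edges_Node -!leaf0.
  have -> : ((a + nedges l, (a + nedges l).+1) \in edges l a) = false.
    by apply/negP => /edges_bound; lia.
  have -> : ((a + nedges l, (a + nedges l).+1) \in edges r (a + nedges l).+1) = false.
    by apply/negP => /edges_bound; lia.
  rewrite !orbF; congr nat_of_bool; apply/eqP/andP => /= [[]|[/eqP-> /eqP->]].
    by split; apply/eqP; lia.
  by congr (_, _); lia.
rewrite -[LHS]/(\sum_(a <= i < a + nedges (Node l r)) F i).
rewrite (@big_cat_nat _ _ _ (a + nedges l)) /=; [|lia|lia].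
rewrite [X in _ + X]big_ltn; last lia.
rewrite Fm -(IHl a) -(IHr (a + nedges l).+1) -[in RHS]addnA [_ + (_ && _)]addnC.
congr (_ + (_ + _)); first exact: eq_big_nat.
rewrite (_ : a + (nedges l + nedges r).+1 = (a + nedges l).+1 + nedges r); last lia.
by apply: eq_big_nat => i /andP[+ _]; exact: Fr.
Qed.

Lemma nmaximaE t a :
  \sum_(a <= y < (a + nedges t).+1) has (fun e => e.2 == y) (edges t a) = nmaxima t.
Proof.
elim: t a => [|l IHl r IHr] a; first by rewrite big1.
pose F y : nat := has (fun e : nat * nat => e.2 == y) (edges (Node l r) a).
have bound s b y : has (fun e : nat * nat => e.2 == y) (edges s b) -> b < y <= b + nedges s.
  by case/hasP=> -[u v] /edges_bound ? /eqP /= <-; lia.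
have FE y : F y = [|| a + nedges (Node l r) == y,
      has (fun e : nat * nat => e.2 == y) (edges l a)
    | has (fun e : nat * nat => e.2 == y) (edges r (a + nedges l).+1)] by rewrite /F /= has_cat.
have Fl y : y <= a + nedges l -> F y = has (fun e => e.2 == y) (edges l a).
  move=> Hy; rewrite FE.
  have -> : has (fun e => e.2 == y) (edges r (a + nedges l).+1) = false.
    by apply/negP => /bound; lia.
  rewrite orbF (_ : (_ == y) = false) //; by apply/negP => /eqP /=; lia.
have Fr y : a + nedges l < y -> F y =
    (a + nedges (Node l r) == y) || has (fun e => e.2 == y) (edges r (a + nedges l).+1).
  move=> Hy; rewrite FE.
  by have -> : has (fun e => e.2 == y) (edges l a) = false by apply/negP => /bound; lia.
rewrite -[LHS]/(\sum_(a <= y < (a + nedges (Node l r)).+1) F y).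
rewrite (@big_cat_nat _ _ _ (a + nedges l).+1) /=; [|lia|lia].
rewrite -(IHl a); congr (_ + _); first by apply: eq_big_nat => y /andP[_]; exact: Fl.
rewrite (_ : (a + (nedges l + nedges r).+1).+1 = ((a + nedges l).+1 + nedges r).+1); last lia.
case: r IHr @F bound FE Fl Fr => [|r1 r2] IHr F bound FE Fl Fr.
  rewrite addn0 big_nat1 Fr //= (_ : _ == _) //=; lia.
rewrite -(IHr (a + nedges l).+1); apply: eq_big_nat => y /andP[ly _]; rewrite Fr //.
(* The last point is the upper end of both the whole root edge and that of [r], so it counts
   once. *)
case: eqP => [yE|//]; congr nat_of_bool; apply/esym/hasP.
exists ((a + nedges l).+1, (a + nedges l).+1 + nedges (Node r1 r2)).
  by rewrite mem_edges_Node eqxx.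
by rewrite -yE /=; apply/eqP; lia.
Qed.

(** * Signed enumeration *)

Lemma card_edgeset_short n t : nedges t = n ->
  #|[set i : 'I_n | (val i, i.+1) \in edges t 0]| = nshort t.
Proof.
move=> tn; rewrite -(nshortE t 0) add0n tn big_mkord -sum1dep_card big_mkcond.
by apply: eq_bigr => i _; case: (_ \in _).
Qed.

Lemma card_edgeset_maxima n t : nedges t = n ->
  #|[set y : 'I_n.+1 | [exists x : 'I_n.+1, (x < y) && adj (edgeset n t) x y]]|
    = nmaxima t.
Proof.
move=> tn; rewrite -(nmaximaE t 0) add0n tn big_mkord -sum1dep_card big_mkcond.
apply: eq_bigr => y _; rewrite (_ : [exists x, _] = has (fun e => e.2 == val y) (edges t 0)).
  by case: (has _ _).
apply/existsP/hasP => [[x /andP[xy]]|[[u v] uv /eqP /= vy]].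
  by rewrite edgeset_lt // => e_xy; exists (val x, val y).
have /and3P[_ lt_uv _] := edges_bound uv; rewrite vy in uv lt_uv.
have un : u < n.+1 by apply: ltn_trans lt_uv _.
by exists (Ordinal un); rewrite edgeset_lt ?lt_uv.
Qed.

(** * Listing the binary trees of a given size *)

(** The recursion on the sizes k and m - k is not structural, so h serves as fuel; every h >= n
    gives all trees with n edges. *)
Fixpoint bintrees_fuel h n : seq bintree :=
  match n, h with
  | 0, _ => [:: Leaf]
  | _.+1, 0 => [::]
  | m.+1, h.+1 =>
      [seq Node lr.1 lr.2 | k <- iota 0 m.+1,
         lr <- [seq (l, r) | l <- bintrees_fuel h k, r <- bintrees_fuel h (m - k)]]
  end.

Lemma bintrees_fuelS h m : bintrees_fuel h.+1 m.+1 =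
  [seq Node lr.1 lr.2 | k <- iota 0 m.+1,
     lr <- [seq (l, r) | l <- bintrees_fuel h k, r <- bintrees_fuel h (m - k)]].
Proof. by []. Qed.

Definition bintrees n := bintrees_fuel n n.

Lemma mem_bintrees_fuel h n t : n <= h -> (t \in bintrees_fuel h n) = (nedges t == n).
Proof.
elim: h n t => [|h IH] [|m] t // mh; try by case: t.
rewrite bintrees_fuelS.
apply/allpairsPdep/eqP => [[k [[l r] [km /allpairsP[[l' r'] [/= lk rk [-> ->]] ->]]]]|].
  rewrite mem_iota in km; rewrite !IH in lk rk; try lia.
  by move/eqP: lk; move/eqP: rk => /=; lia.
case: t => // l r /= [lrm]; exists (nedges l), (l, r); split=> //.
  by rewrite (mem_iota 0 m.+1); lia.
by apply/allpairsP; exists (l, r); split=> //=; rewrite IH; lia.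
Qed.

Lemma uniq_bintrees_fuel h n : n <= h -> uniq (bintrees_fuel h n).
Proof.
elim: h n => [|h IH] [|m] // mh; rewrite bintrees_fuelS.
apply: allpairs_uniq_dep; first exact: iota_uniq.
  move=> k; rewrite mem_iota => km; apply: allpairs_uniq; try (apply: IH; lia).
  by move=> [? ?] [? ?] _ _ [-> ->].
have size_l k lr : k \in iota 0 m.+1 ->
    lr \in [seq (l, r) | l <- bintrees_fuel h k, r <- bintrees_fuel h (m - k)] ->
    nedges lr.1 = k.
  rewrite mem_iota => km /allpairsP[[l r] [/= lk _ ->]] /=.
  by apply/eqP; rewrite -(@mem_bintrees_fuel h) //; lia.
move=> _ _ /allpairsPdep[k [lr [km lrm ->]]] /allpairsPdep[k' [lr' [km' lrm' ->]]] /=.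
move: (size_l _ _ km lrm) (size_l _ _ km' lrm').
by case: lr {lrm} => l r; case: lr' {lrm'} => l' r' /= <- <- [-> ->].
Qed.

Lemma big_bintreesS (R : nmodType) n (w : bintree -> R) :
  (\sum_(t <- bintrees n.+1) w t =
   \sum_(k < n.+1) \sum_(l <- bintrees k) \sum_(r <- bintrees (n - k)) w (Node l r))%R.
Proof.
(* The subtrees are listed with fuel n instead of k, which can only change their order. *)
have fuel k : k <= n -> perm_eq (bintrees_fuel n k) (bintrees k).
  move=> kn; apply: uniq_perm => [||t]; rewrite ?uniq_bintrees_fuel //.
  by rewrite !mem_bintrees_fuel.
rewrite /bintrees bintrees_fuelS big_allpairs_dep.
rewrite -[iota 0 n.+1]/(index_iota 0 n.+1) big_mkord; apply: eq_bigr => k _.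
have kn : k <= n by rewrite leq_ord.
rewrite big_allpairs_dep (perm_big _ (fuel k kn)); apply: eq_bigr => l _ /=.
by rewrite (perm_big _ (fuel (n - k) (leq_subr k n))).
Qed.

(** * Signed weights and their recurrence *)

Local Open Scope ring_scope.

(** Contribution of one tree: the sign comes from its ascents, the power of two counts its
    labellings without levels. *)
Definition weight t : int := (-1) ^+ nmaxima t * 2 ^+ (nedges t - nshort t).

Lemma nshort_leq t : (nshort t <= nedges t)%N.
Proof. by elim: t => //= l IHl r IHr; case: (_ && _); lia. Qed.

(** The root edge doubles the number of labellings unless it joins consecutive points. A leaf on the
    right counts -1 instead of 1, because the last point is then a new maximum. *)
Lemma weight_Node l r : weight (Node l r) =
  (if is_leaf l && is_leaf r then 1 else 2) * weight l *
  (if is_leaf r then -1 else weight r).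
Proof.
have := nshort_leq l; have := nshort_leq r.
rewrite /weight /=; case: (boolP (is_leaf r)) => [|_].
  case: r => // _ _ sl /=; rewrite andbT; case: (boolP (is_leaf l)) => [|_].
    by case: l {sl}.
  rewrite (_ : (_ - _)%N = (nedges l - nshort l).+1); last lia.
  by rewrite addn1 !exprS; ring.
move=> sr sl; rewrite andbF.
rewrite (_ : (_ - _)%N = ((nedges l - nshort l) + (nedges r - nshort r)).+1); last lia.
by rewrite exprS !exprD; ring.
Qed.

Definition total_weight n : int := \sum_(t <- bintrees n) weight t.

Lemma total_weight0 : total_weight 0 = 1.
Proof. by rewrite /total_weight big_seq1. Qed.

Lemma total_weight1 : total_weight 1 = -1.
Proof. by rewrite /total_weight big_seq1. Qed.

Lemma total_weightSS n : total_weight n.+2 =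
  2 * \sum_(k < n) total_weight k.+1 * total_weight (n - k).
Proof.
(* The subtrees have n.+1 edges together, so they are not both leaves and the factor is always 2.
   The value -1 belongs to a leaf on the right. *)
have summand k : (k <= n.+1)%N ->
    \sum_(l <- bintrees k) \sum_(r <- bintrees (n.+1 - k)) weight (Node l r) =
    2 * total_weight k * (if k == n.+1 then -1 else total_weight (n.+1 - k)).
  move=> kn; rewrite mulrAC mulr_sumr; apply: eq_big_seq => l.
  rewrite mem_bintrees_fuel // => /eqP lk.
  have -> : (if k == n.+1 then -1 else total_weight (n.+1 - k)) =
      \sum_(r <- bintrees (n.+1 - k)) (if is_leaf r then -1 else weight r).
    case: eqP => [->|ne]; first by rewrite subnn big_seq1.
    apply: eq_big_seq => -[|//]; rewrite mem_bintrees_fuel //= => /eqP; lia.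
  rewrite mulrAC mulr_sumr; apply: eq_big_seq => r.
  rewrite mem_bintrees_fuel // => /eqP rk; rewrite weight_Node.
  case: l r lk rk => [|? ?] [|? ?] //= lk rk; lia.
rewrite {1}/total_weight big_bintreesS.
under eq_bigr => k _ do rewrite summand ?leq_ord //.
rewrite big_ord_recl big_ord_recr /= subn0 total_weight0 eqxx.
(* The terms with a leaf on the left and with a leaf on the right cancel. *)
rewrite (_ : 2 * 1 * _ + (_ + 2 * _ * -1) = \sum_(i < n) 2 * (total_weight i.+1 * total_weight (n - i))).
  by rewrite -mulr_sumr.
rewrite addrC -addrA mulrN1 mulr1 addNr addr0.
apply: eq_bigr => i _; have i_n := ltn_ord i.
by rewrite /bump /= add1n subSS mulrA ifF //; apply/eqP; lia.
Qed.

(** The sign depends only on the edge set, so the inner sum over the labellings of a fixed tree is a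
    count. *)
Lemma parity_sumE n : parity_sum n.+1 = total_weight n.
Proof.
rewrite /parity_sum /total_weight.
transitivity (\sum_(T : {set {set 'I_n.+1}} * {ffun 'I_n.+1 -> 'I_n.+2}
    | (T.1 \in map (edgeset n) (bintrees n)) && (is_labelling T.2 && level_free T.1 T.2))
    (-1) ^+ ascents T.1 T.2 : int).
  apply: eq_bigl => -[E f] /=; apply/andP/andP.
    case=> /and3P[tE nc lab]; case/(alternatingP tE (is_labelling_mono lab)) => va lf.
    rewrite lab lf; split=> //; have [t tn ->] := tree_edgeset tE nc va.
    by apply: map_f; rewrite mem_bintrees_fuel // tn.
  case=> /mapP[t]; rewrite mem_bintrees_fuel // => /eqP tn -> /andP[lab lf].
  have tE := edgeset_tree tn.
  split; first by rewrite /gnc_tree tE edgeset_nc.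
  apply/(alternatingP tE (is_labelling_mono lab)); split=> //.
  exact: edgeset_alternating.
rewrite -(pair_big_dep _ (fun E f => is_labelling f && level_free E f)
                         (fun E f => (-1) ^+ ascents E f)) /=.
rewrite -big_uniq; last first.
  rewrite map_inj_in_uniq ?uniq_bintrees_fuel // => s t.
  by rewrite !mem_bintrees_fuel // => /eqP sn /eqP tn; exact: edgeset_inj.
rewrite big_map; apply: eq_big_seq => t; rewrite mem_bintrees_fuel // => /eqP tn.
have tE := edgeset_tree tn.
rewrite (eq_bigr (fun=> (-1) ^+ nmaxima t)); last first.
  move=> f /andP[lab lf]; rewrite ascents_tree //; first by rewrite card_edgeset_maxima.
    exact: is_labelling_mono.
  exact: edgeset_alternating.
rewrite (eq_bigl (fun f => f \in [set f | is_labelling f &&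
    ([set i : 'I_n | (val i, i.+1) \in edges t 0] \subset jumps f)])); last first.
  by move=> f; rewrite inE; case: (boolP (is_labelling f)) => //= lab; rewrite level_free_edgeset.
rewrite sumr_const card_labellings_jumps card_edgeset_short //.
by rewrite /weight tn -[LHS]mulr_natr natrX.
Qed.

(** * Catalan numbers and the quadratic recurrence *)

Lemma central_binS j :
  (j.+1 * 'C(2 * j.+1, j.+1) = 2 * (2 * j + 1) * 'C(2 * j, j))%N.
Proof.
rewrite -(mul_bin_diag (2 * j.+1)%N j).
have := mul_bin_down (2 * j).+1 j.
rewrite (_ : (2 * j.+1).-1 = (2 * j).+1)%N; last by lia.
rewrite (_ : (2 * j).+1 - j = j.+1)%N /=; nia.
Qed.

Lemma catalan_convolution n :
  catalan n.+1 = (\sum_(i < n.+1) catalan i * catalan (n - i))%N.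
Proof.
pose cb j : rat := 'C(2 * j, j)%:R.
have cbS j : cb j.+1 = (2 * (2 * j%:R + 1) * cb j) / j.+1%:R.
  apply: (canRL (mulfK _)); first by rewrite pnatr_eq0.
  have /(congr1 (fun m => m%:R : rat)) := central_binS j.
  by rewrite !natrM natrD natrM mulrC.
have catE j : (catalan j)%:R = cb j / j.+1%:R.
  apply: (canRL (mulfK _)); first by rewrite pnatr_eq0.
  by rewrite -natrM catalanE.
(* Gosper's antidifference of the summand. *)
pose g j : rat := cb j * cb (n.+1 - j)%N * (2 * j%:R - n.+1%:R)
                  / (2 * n.+1%:R * n.+2%:R).
apply/eqP; rewrite -(eqr_nat rat) natr_sum; apply/eqP.
transitivity (\sum_(0 <= i < n.+1) (g i.+1 - g i)).
  (* The two ends contribute equally, since g (n + 1) = - g 0. *)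
  rewrite telescope_sumr // /g subnn subn0 catE /cb bin0.
  have := pnatr_eq0 rat n.+1; have := pnatr_eq0 rat n.+2.
  rewrite -!(natr1 n.+1) -(natr1 n) /= => /negbT h1 /negbT h2.
  by field; rewrite h1 h2.
rewrite big_mkord; apply: eq_bigr => -[i /= i_n] _.
rewrite natrM !catE /g subSS.
(* Writing n = i + m removes the truncated subtraction, so that [field] applies. *)
have [m ->] : exists m, n = (i + m)%N by exists (n - i)%N; rewrite subnKC // -ltnS.
have -> : ((i + m).+1 - i = m.+1)%N by lia.
rewrite addKn !cbS -!(natr1 (i + m).+1) -!(natr1 (i + m)) -!(natr1 i) -!(natr1 m) natrD.
have h j : (j%:R + 1 : rat) != 0 by rewrite natr1 pnatr_eq0.
have h1 : (i%:R + m%:R + 1 : rat) != 0 by rewrite -natrD h.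
have h2 : (i%:R + m%:R + 1 + 1 : rat) != 0 by rewrite -natrD natr1 h.
by field; rewrite ?h ?h1 ?h2.
Qed.

(** These are the coefficients of F = -x + 2 x F^2, an odd series. In a product whose indices have
    odd sum one index is even and its factor vanishes; for an even sum only pairs of odd indices
    survive, and they form the Catalan convolution. *)
Lemma signed_catalan_conv (B : nat -> int) :
  B 0 = 0 -> B 1 = -1 ->
  (forall n, B n.+2 = 2 * \sum_(k < n.+2) B k * B (n.+1 - k)%N) ->
  forall n, B (2 * n)%N = 0 /\
            B (2 * n).+1 = (-1) ^+ n.+1 * 2 ^+ n * (catalan n)%:Z.
Proof.
move=> B0 B1 BS; elim/ltn_ind => -[|n] IH.
  by rewrite muln0 B0 B1.
have even_split m (F : nat -> int) :
    \sum_(k < (2 * m)) F k = \sum_(i < m) (F (2 * i)%N + F (2 * i).+1).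
  elim: m => [|m IHm]; first by rewrite muln0 !big_ord0.
  rewrite (_ : 2 * m.+1 = (2 * m).+2)%N; last by lia.
  by rewrite !big_ord_recr /= IHm addrA.
have ev : B (2 * n.+1)%N = 0.
  rewrite (_ : 2 * n.+1 = (2 * n).+2)%N; last by lia.
  rewrite BS (_ : (2 * n).+2 = 2 * n.+1)%N; last by lia.
  rewrite (even_split _ (fun k => B k * B ((2 * n).+1 - k)%N)) big1 ?mulr0 // => i _; have i_n := ltn_ord i.
  have -> : ((2 * n).+1 - (2 * i).+1 = 2 * (n - i))%N by lia.
  have [-> _] := IH i i_n; have [|-> _] := IH (n - i)%N; first by lia.
  by rewrite mul0r mulr0 addr0.
split=> //.
rewrite (_ : (2 * n.+1).+1 = (2 * n).+1.+2)%N; last by lia.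
(* The number of summands is odd; the last one vanishes by [ev], and the others are grouped in
   pairs. *)
rewrite BS big_ord_recr /= (_ : (2 * n).+2 = 2 * n.+1)%N; last by lia.
rewrite ev mul0r addr0 (even_split _ (fun k => B k * B (2 * n.+1 - k)%N)) catalan_convolution.
rewrite (_ : (\sum_(i < n.+1) catalan i * catalan (n - i))%N%:Z =
             \sum_(i < n.+1) (catalan i)%:Z * (catalan (n - i))%:Z); last first.
  by rewrite -natz natr_sum; apply: eq_bigr => i _; rewrite natrM !natz.
rewrite !mulr_sumr; apply: eq_bigr => -[i /= i_n] _.
have -> : (2 * n.+1 - (2 * i).+1 = (2 * (n - i)).+1)%N by lia.
have [-> ->] := IH i i_n; have [|_ ->] := IH (n - i)%N; first by lia.
have [m ->] : exists m, n = (i + m)%N by exists (n - i)%N; rewrite subnKC // -ltnS.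
rewrite addKn mul0r add0r !exprS !exprD.
ring.
Qed.

Close Scope ring_scope.

Theorem theorem3p9 (n : nat) :
  parity_sum (2 * n + 3) = 0%R /\
  parity_sum (2 * n + 2) = ((-1) ^+ n.+1 * 2 ^+ n * (catalan n)%:Z)%R.
Proof.
(* The value at 0 is changed from 1 to 0, as F omits the one-vertex tree; the recurrence then
   becomes a full convolution. *)
pose B n : int := if n is 0%N then 0%R else total_weight n.
have BS m : B m.+2 = (2 * \sum_(k < m.+2) B k * B (m.+1 - k)%N)%R.
  rewrite /B total_weightSS big_ord_recl mul0r add0r big_ord_recr /=.
  rewrite /bump /= add1n subnn mulr0 addr0; congr (_ * _)%R.
  apply: eq_bigr => k _; have k_m := ltn_ord k.
  by rewrite /bump /= add1n subSS; case: (m - k)%N (subn_gt0 k m) => //; rewrite k_m.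
have conv := signed_catalan_conv (B := B) erefl total_weight1 BS.
rewrite (_ : 2 * n + 3 = (2 * n.+1).+1)%N; last lia.
rewrite (_ : 2 * n + 2 = (2 * n).+2)%N; last lia.
rewrite !parity_sumE; split; last by have [_ <-] := conv n.
by have [<- _] := conv n.+1; rewrite /B mulnS.
Qed.
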